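(* Let $Q$ be a $k$-subset problem that is superset-closed and that has an FPT algorithm (running time $f(k)\cdot\mathrm{poly}(|I|)$) enumerating all its inclusion-minimal solutions for any instance $(I,k)$, where the number of minimal solutions is bounded by a function of $k$. Then $Q$ Reconfiguration parameterized by $k$ is in FPT, and so are its search variant and its shortest path variant.
   Context: A $k$-subset problem is a parameterized problem $Q$ whose solutions for an instance $(I,k)$ are subsets of size at most $k$ of a domain set (determined by $I$). $Q$ is superset-closed if every superset of size at most $k$ of a solution is also a solution. $Q$ Reconfiguration: given an instance $(I,k)$, two solutions $S,T$ and an integer $\ell$, decide whether there is a sequence $S=U_0,U_1,\dots,U_m=T$ with $m\le \ell$ in which every $U_i$ is a solution of $(I,k)$ (so $|U_i|\le k$) and any two consecutive sets differ by the addition or deletion of exactly one element. The search variant must output such a sequence (a reconfiguration sequence) if one exists; the shortest path variant must output such a sequence of minimum length. A parameterized problem is in FPT if it is decidable/solvable in time $g(p)\cdot n^{c}$ for a function $g$ of the parameter $p$ and a constant $c$. *)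

(* Defs.v *)
From Corelib Require Import PosDef.
From mathcomp Require Import all_boot all_order all_algebra finmap.

Set Implicit Arguments.
Unset Strict Implicit.
Unset Printing Implicit Defensive.

Import Order.TTheory GRing.Theory Num.Theory.

Local Open Scope fset_scope.

(* Algorithms are programs of a first-order, call-by-value functional language
   over binary trees (Jones' language F; N. D. Jones, Computability and
   Complexity from a Programming Perspective, 1997).  Time is the number of
   evaluation steps.  With the usual pointer representation of trees every step
   costs O(1) and allocates at most one cell, so that, for inputs and outputs
   written out in full, running times on this model and on multitape Turing
   machines are polynomially related in both directions. *)

Inductive data : Type :=
| Leaf
| Node of data & data.

Fixpoint dsize (d : data) : nat :=
  if d is Node a b then (dsize a + dsize b).+1 else 1.

(* Variables are de Bruijn indices.  [Case e e0 e1] evaluates [e]; on [Leaf] it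
   continues with [e0], on [Node a b] with [e1], in which variables 0 and 1 are
   [a] and [b].  [Let e e1] binds variable 0 of [e1] to the value of [e].
   [Call f e] applies the [f]-th function, whose body has as its only free
   variable 0, its argument. *)
Inductive expr : Type :=
| Var of nat
| Nil
| Cons of expr & expr
| Case of expr & expr & expr
| Let of expr & expr
| Call of nat & expr.

Record program : Type := Program { defs : seq expr; main : expr }.

(* [eval F env e v t]: with function bodies [F], in environment [env], the
   expression [e] evaluates to [v] in [t] steps. *)
Inductive eval (F : seq expr) : seq data -> expr -> data -> nat -> Prop :=
| eval_var env i : eval F env (Var i) (nth Leaf env i) 1
| eval_nil env : eval F env Nil Leaf 1
| eval_cons env e1 e2 v1 v2 t1 t2 :
    eval F env e1 v1 t1 -> eval F env e2 v2 t2 ->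
    eval F env (Cons e1 e2) (Node v1 v2) (t1 + t2).+1
| eval_case_leaf env e e0 e1 v t t0 :
    eval F env e Leaf t -> eval F env e0 v t0 ->
    eval F env (Case e e0 e1) v (t + t0).+1
| eval_case_node env e e0 e1 a b v t t1 :
    eval F env e (Node a b) t -> eval F [:: a, b & env] e1 v t1 ->
    eval F env (Case e e0 e1) v (t + t1).+1
| eval_let env e e1 u v t t1 :
    eval F env e u t -> eval F (u :: env) e1 v t1 ->
    eval F env (Let e e1) v (t + t1).+1
| eval_call env f e u v t t1 :
    f < size F ->
    eval F env e u t -> eval F [:: u] (nth Nil F f) v t1 ->
    eval F env (Call f e) v (t + t1).+1.

Definition runs (p : program) (x v : data) (t : nat) : Prop :=
  eval (defs p) [:: x] (main p) v t.

Definition word : Type := seq bool.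

Definition enc_bool (b : bool) : data := if b then Node Leaf Leaf else Leaf.

Definition enc_seq (A : Type) (enc : A -> data) (s : seq A) : data :=
  foldr (fun a d => Node (enc a) d) Leaf s.

Definition enc_word : word -> data := enc_seq enc_bool.

Definition enc_option (A : Type) (enc : A -> data) (o : option A) : data :=
  if o is Some a then Node (enc a) Leaf else Leaf.

(* Numbers are written in binary, least significant bit first, without
   leading zeros. *)
Fixpoint pos_bits (p : positive) : word :=
  match p with
  | xH => [:: true]
  | xO q => false :: pos_bits q
  | xI q => true :: pos_bits q
  end.

Definition nat_bits (n : nat) : word :=
  if bin_of_nat n is Npos p then pos_bits p else [::].

Definition enc_nat (n : nat) : data := enc_word (nat_bits n).

Definition enc_int (z : int) : data :=
  Node (enc_bool (z < 0)%R) (enc_nat `|z|%N).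

(* A finite set of words is written as a list of its elements, in an arbitrary
   order and without repetition. *)
Definition set_of (s : seq word) : {fset word} := [fset w in s].

Definition enc_listing : seq word -> data := enc_seq enc_word.

Definition enc_listings : seq (seq word) -> data := enc_seq enc_listing.

(* [correct x v]: [v] is an admissible output on the input [x].  Nothing is
   required on inputs that are not [valid]. *)
Record param_problem : Type := ParamProblem {
  input : Type;
  valid : input -> Prop;
  encode : input -> data;
  param : input -> nat;
  correct : input -> data -> Prop
}.

(* [dsize v] accounts for writing out the output in full, which the step count
   does not bound because values may share subtrees. *)
Definition in_FPT (P : param_problem) : Prop :=
  exists (p : program) (g : nat -> nat) (c : nat),
    forall x : input P, valid x ->
      exists (v : data) (t : nat),
        [/\ runs p (encode x) v t,
            t + dsize v <= g (param x) * dsize (encode x) ^ c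
          & correct x v].

(* Every pair (I, k) is an instance; a word I that encodes no object of interest
   is one without solutions. *)
Record subset_problem : Type := SubsetProblem {
  domain : word -> {pred word};
  solution : word -> nat -> {fset word} -> Prop;
  solution_domain : forall (I : word) (k : nat) (S : {fset word}),
    solution I k S -> {subset S <= domain I};
  solution_card : forall (I : word) (k : nat) (S : {fset word}),
    solution I k S -> #|` S| <= k
}.

Definition superset_closed (Q : subset_problem) : Prop :=
  forall (I : word) (k : nat) (S S' : {fset word}),
    solution Q I k S -> S `<=` S' -> {subset S' <= domain Q I} ->
    #|` S'| <= k -> solution Q I k S'.

Definition minimal_solution (Q : subset_problem) (I : word) (k : nat)
    (S : {fset word}) : Prop :=
  solution Q I k S /\
  forall S' : {fset word}, solution Q I k S' -> S' `<=` S -> S' = S.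

Definition minimal_solutions_bounded (Q : subset_problem) : Prop :=
  exists h : nat -> nat, forall (I : word) (k : nat),
    exists A : {fset {fset word}},
      (forall S : {fset word}, S \in A <-> minimal_solution Q I k S) /\
      #|` A| <= h k.

Definition minimal_enumeration (Q : subset_problem) : param_problem :=
  {| input := word * nat;
     valid := fun=> True;
     encode := fun x => Node (enc_word x.1) (enc_nat x.2);
     param := fun x => x.2;
     correct := fun x v => exists L : seq (seq word),
       [/\ v = enc_listings L,
           all uniq L
         & forall S : {fset word},
             S \in map set_of L <-> minimal_solution Q x.1 x.2 S] |}.

Definition adjacent (U V : {fset word}) : Prop :=
  exists w : word,
    (w \notin U /\ V = w |` U) \/ (w \in U /\ V = U `\ w).

Definition reconf_sequence (Q : subset_problem) (I : word) (k : nat)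
    (S T : {fset word}) (m : nat) (U : seq {fset word}) : Prop :=
  [/\ size U = m.+1,
      nth fset0 U 0 = S,
      nth fset0 U m = T,
      forall i, i <= m -> solution Q I k (nth fset0 U i)
    & forall i, i < m -> adjacent (nth fset0 U i) (nth fset0 U i.+1)].

Record reconf_input : Type := ReconfInput {
  r_inst : word;
  r_k : nat;
  r_source : seq word;
  r_target : seq word
}.

Definition r_valid (Q : subset_problem) (x : reconf_input) : Prop :=
  [/\ uniq (r_source x), uniq (r_target x),
      solution Q (r_inst x) (r_k x) (set_of (r_source x))
    & solution Q (r_inst x) (r_k x) (set_of (r_target x))].

Definition enc_reconf (x : reconf_input) : data :=
  Node (enc_word (r_inst x))
    (Node (enc_nat (r_k x))
      (Node (enc_listing (r_source x)) (enc_listing (r_target x)))).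

Definition is_reconf (Q : subset_problem) (x : reconf_input) (m : nat)
    (U : seq {fset word}) : Prop :=
  reconf_sequence Q (r_inst x) (r_k x)
    (set_of (r_source x)) (set_of (r_target x)) m U.

Definition is_reconf_within (Q : subset_problem) (x : reconf_input) (l : int)
    (m : nat) (U : seq {fset word}) : Prop :=
  is_reconf Q x m U /\ (m%:Z <= l)%R.

Definition is_shortest (good : nat -> seq {fset word} -> Prop) (m : nat)
    (U : seq {fset word}) : Prop :=
  good m U /\ forall m' U', good m' U' -> m <= m'.

Definition sequence_answer (good : nat -> seq {fset word} -> Prop) (v : data)
    : Prop :=
  (exists m (us : seq (seq word)),
     [/\ v = enc_option enc_listings (Some us),
         all uniq us
       & good m (map set_of us)])
  \/ (v = enc_option enc_listings None /\ forall m U, ~ good m U).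

Definition reconfiguration (Q : subset_problem) : param_problem :=
  {| input := reconf_input * int;
     valid := fun x => r_valid Q x.1;
     encode := fun x => Node (enc_reconf x.1) (enc_int x.2);
     param := fun x => r_k x.1;
     correct := fun x v => exists b : bool,
       v = enc_bool b /\
       (b <-> exists m U, is_reconf_within Q x.1 x.2 m U) |}.

Definition reconfiguration_search (Q : subset_problem) : param_problem :=
  {| input := reconf_input * int;
     valid := fun x => r_valid Q x.1;
     encode := fun x => Node (enc_reconf x.1) (enc_int x.2);
     param := fun x => r_k x.1;
     correct := fun x v => sequence_answer (is_reconf_within Q x.1 x.2) v |}.

Definition reconfiguration_shortest_within (Q : subset_problem)
    : param_problem :=
  {| input := reconf_input * int;
     valid := fun x => r_valid Q x.1;
     encode := fun x => Node (enc_reconf x.1) (enc_int x.2);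
     param := fun x => r_k x.1;
     correct := fun x v =>
       sequence_answer (is_shortest (is_reconf_within Q x.1 x.2)) v |}.

Definition reconfiguration_shortest (Q : subset_problem) : param_problem :=
  {| input := reconf_input;
     valid := r_valid Q;
     encode := enc_reconf;
     param := r_k;
     correct := fun x v => sequence_answer (is_shortest (is_reconf Q x)) v |}.

(* Main.v *)
Require Import Defs.
From mathcomp Require Import all_boot all_order all_algebra finmap.
From mathcomp Require Import zify.
From Stdlib Require Import Classical.
(* mathcomp's [Nil] and [Cons] must not hide the expression constructors. *)
Import Defs.

(** Let [C] be the set of all words of [S], of [T] and of the minimal solutions;
    it has at most [h(k) * k + 2 * k] elements.  Intersecting a reconfiguration
    sequence with [C] gives solutions again, because a set is a solution as soon
    as it has at most [k] elements, all in the domain, and contains a minimal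
    solution; so only subsets of [C] matter, and a shortest sequence has at most
    [2 ^ |C|] steps.  The program therefore looks for walks of exactly [m]
    steps, [m = 0, 1, ..., 2 ^ |C|], by exhaustive search over the words of [C]
    to add or delete, and the first walk found is shortest. *)

Set Implicit Arguments.
Unset Strict Implicit.
Unset Printing Implicit Defensive.

Local Open Scope fset_scope.
Local Open Scope nat_scope.

(** * Walks among the subsets of the core *)

(** The cost controlled by [k] has to be kept apart from the cost that is only polynomial. Neither
    the lengths of the words nor the number of entries of the enumerated list is bounded in [k]: a
    minimal solution may be listed several times, with its words in different orders. Only the
    number of words of the core is bounded, so it alone enters the exponent, while the sizes of
    encodings enter polynomially. The program never evaluates [h]; it reads |C| off the core it has
    computed, and [h] occurs in the analysis only. The search keeps no table of visited sets: coming
    back to a set costs a factor that depends on |C| alone, and repetitions are removed in the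
    proof, where this limits the lengths to be tried. *)

Fixpoint toggled (w : word) (U : seq word) : seq word :=
  if U is x :: U' then if x == w then U' else x :: toggled w U' else [:: w].

Fixpoint merged (l acc : seq word) : seq word :=
  if l is x :: l' then merged l' (if x \in acc then acc else x :: acc) else acc.

Fixpoint merged_all (L : seq (seq word)) (acc : seq word) : seq word :=
  if L is A :: L' then merged_all L' (merged A acc) else acc.

Lemma mem_merged w l acc : (w \in merged l acc) = (w \in l) || (w \in acc).
Proof.
elim: l acc => //= x l IH acc; rewrite IH inE -orbA orbCA.
case: ifP => // xacc.
by case: (w =P x) => // ->; rewrite xacc !orbT.
Qed.

Lemma uniq_merged l acc : uniq acc -> uniq (merged l acc).
Proof.
by elim: l acc => //= x l IH acc uacc; apply: IH; case: ifP => //= ->.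
Qed.

Lemma mem_merged_all w L acc :
  (w \in merged_all L acc)
  = has (fun A : seq word => w \in A) L || (w \in acc).
Proof.
elim: L acc => //= A L IH acc; rewrite IH mem_merged.
by rewrite orbA [_ || (w \in A)]orbC.
Qed.

Lemma uniq_merged_all L acc : uniq acc -> uniq (merged_all L acc).
Proof. by elim: L acc => //= A L IH acc uacc; apply/IH/uniq_merged. Qed.

Definition core (L : seq (seq word)) (S T : seq word) : seq word :=
  merged_all L (merged S (merged T [::])).

Lemma mem_core L S T w :
  (w \in core L S T)
  = [|| w \in S, w \in T | has (fun A : seq word => w \in A) L].
Proof. by rewrite mem_merged_all !mem_merged orbF orbC orbA. Qed.

Lemma uniq_core L S T : uniq (core L S T).
Proof. by rewrite uniq_merged_all ?uniq_merged. Qed.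

Lemma mem_toggled w U x :
  uniq U -> (x \in toggled w U) = (x \in U) (+) (x == w).
Proof.
elim: U => [|y U IH] /=; first by rewrite !inE.
case/andP=> nyU /IH {}IH; case: (y =P w) nyU => [-> nwU | /eqP nyw _].
  by rewrite inE; case: (x =P w) nwU => [-> /negbTE -> | _] //=; rewrite addbF.
rewrite !inE IH; case: (x =P y) => //= ->.
by rewrite (negbTE nyw).
Qed.

Lemma uniq_toggled w U : uniq U -> uniq (toggled w U).
Proof.
elim: U => [|y U IH] //= /andP[nyU uU]; case: (y =P w) => [//|/eqP nyw] /=.
by rewrite mem_toggled // (negbTE nyU) (negbTE nyw) IH.
Qed.

Lemma in_set_of s x : (x \in set_of s) = (x \in s).
Proof. by rewrite inE. Qed.

Lemma card_set_of s : uniq s -> #|` set_of s| = size s.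
Proof. by move=> us; rewrite card_fseq undup_id. Qed.

Lemma set_of_sub (s : seq word) (X : {fset word}) :
  reflect {subset s <= X} (set_of s `<=` X).
Proof.
by apply: (iffP (@fsubsetP _ _ _)) => sub x; have := sub x; rewrite in_set_of.
Qed.

Definition flip (w : word) (X : {fset word}) : {fset word} :=
  if w \in X then X `\ w else w |` X.

Lemma in_flip w X x : (x \in flip w X) = (x \in X) (+) (x == w).
Proof.
rewrite /flip; case: ifP => wX; rewrite !inE; case: (x =P w) => [->|] //=.
- by rewrite wX.
- by rewrite addbF.
- by rewrite wX.
- by rewrite addbF.
Qed.

Lemma set_of_toggled w U : uniq U -> set_of (toggled w U) = flip w (set_of U).
Proof.
by move=> uU; apply/fsetP=> x; rewrite in_flip !in_set_of mem_toggled.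
Qed.

Lemma adjacent_flip U V : adjacent U V <-> exists w, V = flip w U.
Proof.
split=> -[w].
  by case=> -[wU ->]; exists w; rewrite /flip ?wU ?(negbTE wU).
by move=> ->; exists w; rewrite /flip; case: ifP => wU; [right | left].
Qed.

Section Walks.

Variables (C T : seq word) (L : seq (seq word)) (k : nat).

Definition feasible (U : seq word) : bool :=
  (size U <= k) && has (all [in U]) L.

Fixpoint try_moves (f : seq word -> option (seq (seq word))) (U Cr : seq word)
    : option (seq (seq word)) :=
  if Cr is w :: Cr' then
    let U' := toggled w U in
    if feasible U' then
      if f U' is Some W then Some (U :: W) else try_moves f U Cr'
    else try_moves f U Cr'
  else None.

Fixpoint find_walk (m : nat) (U : seq word) : option (seq (seq word)) :=
  if m is m'.+1 then try_moves (find_walk m') U C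
  else if all [in T] U && all [in U] T then Some [:: U] else None.

Fixpoint shortest_walk (fuel m : nat) (U : seq word)
    : option (seq (seq word)) :=
  if find_walk m U is Some us then Some us
  else if fuel is fuel'.+1 then shortest_walk fuel' m.+1 U else None.

(** A decidable substitute for being a solution. It does not test membership in the domain, which
    the program could not do; subsets of the core satisfy that condition anyway. *)
Definition good_set (X : {fset word}) : bool :=
  (#|` X| <= k) && has (fun A => set_of A `<=` X) L.

Definition move (X Y : {fset word}) : bool :=
  good_set Y && has (fun w => Y == flip w X) C.

Lemma feasibleE U : uniq U -> feasible U = good_set (set_of U).
Proof.
move=> uU; rewrite /feasible /good_set card_set_of //; congr (_ && _).
by apply: eq_has => A; apply/allP/set_of_sub => sub x /sub;
  rewrite /= in_set_of.
Qed.

Lemma set_of_eq U :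
  all [in T] U && all [in U] T = (set_of U == set_of T).
Proof.
apply/andP/eqP=> [[/allP UT /allP TU] | eqUT].
  by apply/fsetP=> x; rewrite !in_set_of; apply/idP/idP => [/UT|/TU].
by split; apply/allP=> x /=;
  rewrite -[x \in U]in_set_of -[x \in T]in_set_of eqUT.
Qed.

Lemma try_moves_sound f U Cr us :
  try_moves f U Cr = Some us ->
  exists w W, [/\ w \in Cr, feasible (toggled w U),
                 f (toggled w U) = Some W & us = U :: W].
Proof.
elim: Cr => //= w Cr IH; case: ifP => [feas | _].
  case def_f: (f _) => [W|]; first by case=> <-; exists w, W; rewrite mem_head.
  by case/IH=> w' [W [inC ? ? ?]]; exists w', W; rewrite inE inC orbT.
by case/IH=> w' [W [inC ? ? ?]]; exists w', W; rewrite inE inC orbT.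
Qed.

(** Only success is claimed, not a walk through [w]: an earlier word of [Cr] may already have
    succeeded. *)
Lemma try_moves_complete f U Cr w :
  w \in Cr -> feasible (toggled w U) -> f (toggled w U) != None ->
  try_moves f U Cr != None.
Proof.
move=> inC feas ff; elim: Cr inC => //= w' Cr IH; rewrite inE.
case/orP=> [/eqP <- | /IH {}IH]; first by rewrite feas; case: (f _) ff.
by case: ifP => // _; case: (f _).
Qed.

Lemma find_walk_sound m U us :
  uniq U -> find_walk m U = Some us ->
  exists p, [/\ all uniq us, [seq set_of V | V <- us] = set_of U :: p,
               size p = m, path move (set_of U) p
             & last (set_of U) p = set_of T].
Proof.
elim: m U us => [|m IH] U us uU /=.
  rewrite set_of_eq; case: eqP => // eqUT [<-]; exists [::].
  by split; rewrite //= uU.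
case/try_moves_sound=> w [W [wC feas /IH]].
case/(_ (uniq_toggled w uU))=> p [uW defW szp pathp lastp] ->.
exists (set_of (toggled w U) :: p); split=> //=; rewrite ?uU ?defW ?szp //.
rewrite pathp andbT /move -feasibleE ?uniq_toggled // feas /=.
by apply/hasP; exists w; rewrite ?set_of_toggled.
Qed.

Lemma find_walk_complete p U :
  uniq U -> path move (set_of U) p -> last (set_of U) p = set_of T ->
  find_walk (size p) U != None.
Proof.
elim: p U => [|Y p IH] U uU /=; first by move=> _ /eqP; rewrite set_of_eq => ->.
case/andP=> /andP[goodY /hasP[w wC /eqP defY]] pathp lastp.
rewrite -set_of_toggled // in defY.
apply: (try_moves_complete wC); first by rewrite feasibleE ?uniq_toggled -?defY.
by apply: IH; rewrite ?uniq_toggled -?defY.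
Qed.

Lemma shortest_walk_some fuel m U us :
  shortest_walk fuel m U = Some us ->
  exists2 j, find_walk j U = Some us
    & forall i, m <= i < j -> find_walk i U = None.
Proof.
elim: fuel m => [|fuel IH] m /=; case def_f: (find_walk m U) => [W|//].
- by case=> <-; exists m => // i; lia.
- by case=> <-; exists m => // i; lia.
case/IH=> j eqj minj; exists j => // i /andP[mi ij].
by case: (ltngtP m i) mi => [mi _ | // | <- _ //]; apply: minj; rewrite mi.
Qed.

Lemma shortest_walk_none fuel m U i :
  shortest_walk fuel m U = None -> m <= i <= m + fuel -> find_walk i U = None.
Proof.
elim: fuel m => [|fuel IH] m /=; case def_f: (find_walk m U) => [//|].
  by move=> _ mi; have -> : i = m by lia.
move=> /IH {}IH /andP[mi im].
case: (ltngtP m i) mi => [mi _ | // | <- _ //]; apply: IH; lia.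
Qed.

End Walks.

(** * Reconfiguration sequences and walks inside the core *)

Section Reconfiguration.

Variables (Q : subset_problem) (I : word) (k : nat).
Variables (C S T : seq word) (L : seq (seq word)).

Hypothesis Q_closed : superset_closed Q.
Hypothesis S_uniq : uniq S.
Hypothesis solS : solution Q I k (set_of S).
Hypothesis solT : solution Q I k (set_of T).
Hypothesis L_minimal : forall X : {fset word},
  X \in map set_of L <-> minimal_solution Q I k X.
Hypothesis mem_C : forall w,
  (w \in C) = [|| w \in S, w \in T | has (fun A : seq word => w \in A) L].

(** A solution that is not minimal contains a strictly smaller one, and cardinality stops the
    descent. Being a solution is an arbitrary proposition, hence the excluded middle. *)
Lemma minimal_below X :
  solution Q I k X -> exists2 A, A \in L & set_of A `<=` X.
Proof.
have [n] := ubnP #|` X|; elim: n X => // n IH X ltXn solX.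
have [minX | nminX] := classic (minimal_solution Q I k X).
  have /mapP[A AL defX] := (L_minimal X).2 minX.
  by exists A => //; rewrite -defX.
have [Y solY /andP[YX neYX]] :
    exists2 Y, solution Q I k Y & (Y `<=` X) && (Y != X).
  apply: NNPP => noY; case: nminX; split=> // Y solY YX.
  by apply/eqP; apply: contra_notT noY => neYX; exists Y; rewrite ?YX.
have ltYX : #|` Y| < #|` X|.
  by apply: fproper_ltn_card; rewrite fproperEneq neYX.
have [A AL AY] := IH Y (leq_trans ltYX ltXn) solY.
by exists A => //; apply: fsubset_trans YX.
Qed.

(** This is where superset closure enters: the listed set below [X] is a solution, and the remaining
    conditions on [X] are those that closure asks for. *)
Lemma good_solution X :
  good_set L k X -> {subset X <= domain Q I} -> solution Q I k X.
Proof.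
case/andP=> cardX /hasP[A AL AX] domX.
have [solA _] := (L_minimal (set_of A)).1 (map_f set_of AL).
exact: Q_closed AX _ _.
Qed.

Lemma C_domain : {subset C <= domain Q I}.
Proof.
move=> w; rewrite mem_C; case/or3P=> [wS | wT | /hasP[A AL wA]].
- by apply: (solution_domain solS); rewrite in_set_of.
- by apply: (solution_domain solT); rewrite in_set_of.
have [solA _] := (L_minimal (set_of A)).1 (map_f set_of AL).
by apply: (solution_domain solA); rewrite in_set_of.
Qed.

Lemma move_sub X Y : move C L k X Y -> X `<=` set_of C -> Y `<=` set_of C.
Proof.
case/andP=> _ /hasP[w wC /eqP ->] /fsubsetP XC; apply/fsubsetP=> x.
rewrite in_flip; case: (x =P w) => [-> _ | _]; first by rewrite in_set_of.
by rewrite addbF; apply: XC.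
Qed.

Lemma path_sub X p :
  path (move C L k) X p -> X `<=` set_of C -> {in p, forall Y, Y `<=` set_of C}.
Proof.
elim: p X => //= Y p IH X /andP[mv pathp] /(move_sub mv) YC Z.
by rewrite inE => /predU1P[-> // | ]; apply: IH pathp YC Z.
Qed.

Lemma S_sub : set_of S `<=` set_of C.
Proof. by apply/set_of_sub=> x xS; rewrite in_set_of mem_C xS. Qed.

Lemma T_sub : set_of T `<=` set_of C.
Proof. by apply/set_of_sub=> x xT; rewrite in_set_of mem_C xT orbT. Qed.

Lemma path_reconf X p :
  solution Q I k X -> X `<=` set_of C -> path (move C L k) X p ->
  reconf_sequence Q I k X (last X p) (size p) (X :: p).
Proof.
move=> solX XC pathp; have pC := path_sub pathp XC.
split; rewrite ?(last_nth fset0) //.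
- case=> [|i] //= ltip; have inp := mem_nth fset0 ltip.
  apply: good_solution; first by have /(pathP fset0)/(_ i ltip)/andP[] := pathp.
  move=> x xY; apply: C_domain; rewrite -in_set_of.
  exact: (fsubsetP (pC _ inp)).
- move=> i ltip; apply/adjacent_flip => /=.
  have /(pathP fset0)/(_ i ltip)/andP[_ /hasP[w _ /eqP ->]] := pathp.
  by exists w.
Qed.

(* Intersecting every set of a reconfiguration sequence with [C] keeps it above
   a minimal solution and turns each step into a move or a repetition. *)
Lemma reconf_path m U :
  reconf_sequence Q I k (set_of S) (set_of T) m U ->
  exists p, [/\ path (move C L k) (set_of S) p, last (set_of S) p = set_of T,
               size p <= m & size p <= 2 ^ size C].
Proof.
case=> _ U0 Um solU adjU.
have good i : i <= m -> good_set L k (nth fset0 U i `&` set_of C).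
  move=> /solU solUi; rewrite /good_set.
  have leUi := solution_card solUi.
  rewrite (leq_trans (fsubset_leq_card (fsubsetIl _ _)) leUi) /=.
  have [A AL AU] := minimal_below solUi; apply/hasP; exists A => //.
  rewrite fsubsetI AU; apply/set_of_sub=> x xA; rewrite in_set_of mem_C.
  by apply/or3P/Or33/hasP; exists A.
have [p [pathp lastp lep]] : exists p,
    [/\ path (move C L k) (set_of S) p,
        last (set_of S) p = nth fset0 U m `&` set_of C & size p <= m].
  have : m <= m by [].
  elim: {-2}m => [|i IH] leim.
    by exists [::]; split=> //=; rewrite U0; apply/esym/fsetIidPl/S_sub.
  have [p [pathp lastp lep]] := IH (ltnW leim).
  have [w defU] := (adjacent_flip _ _).1 (adjU i leim).
  have [wC | nwC] := boolP (w \in C).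
    exists (rcons p (nth fset0 U i.+1 `&` set_of C)).
    rewrite rcons_path last_rcons size_rcons pathp lastp; split=> //=.
    rewrite /move good //=; apply/hasP; exists w => //; apply/eqP/fsetP=> x.
    rewrite in_flip !inE defU in_flip.
    by case: (x =P w) => [-> | _]; rewrite ?wC ?andbT ?addbF.
  exists p; rewrite lastp; split=> //; last by lia.
  apply/fsetP=> x; rewrite !inE defU in_flip.
  by case: (x =P w) => [-> | _]; rewrite ?(negbTE nwC) ?andbF ?addbF.
rewrite Um in lastp; have TC : set_of T `&` set_of C = set_of T.
  by apply/fsetIidPl/T_sub.
rewrite {}TC in lastp.
(* Cutting out loops makes the visited sets pairwise distinct subsets of [C], so counting the
   powerset bounds the length; it also never lengthens the walk. *)
move: lastp; case: (shortenP pathp) => q pathq uq qp lastq.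
exists q; split=> //.
  by apply: leq_trans (uniq_leq_size _ qp) lep; case/andP: uq.
have le_card : #|` set_of C| <= size C by rewrite card_fseq size_undup.
apply: leq_trans (_ : 2 ^ #|` set_of C| <= _); last by rewrite leq_exp2l.
rewrite -card_fpowerset -[size q]/(size (set_of S :: q)).-1.
apply: leq_trans (leq_pred _) _; apply: uniq_leq_size => // X.
rewrite fpowersetE inE => /predU1P[-> | ]; first exact: S_sub.
exact: path_sub pathq S_sub _.
Qed.

Definition answer : option (seq (seq word)) :=
  shortest_walk C T L k (2 ^ size C) 0 S.

Lemma answer_some us :
  answer = Some us ->
  [/\ all uniq us, size us <= (2 ^ size C).+1,
      {in us, forall V : seq word, {subset V <= C}}
    & is_shortest (reconf_sequence Q I k (set_of S) (set_of T))
        (size us).-1 [seq set_of V | V <- us]].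
Proof.
move=> ans; have [j found minj] := shortest_walk_some ans.
have [p [uus defus szp pathp lastp]] := find_walk_sound S_uniq found.
have szus : size us = (size p).+1 by rewrite -(size_map set_of) defus.
have recp := path_reconf solS S_sub pathp; rewrite lastp in recp.
have short m' U' : reconf_sequence Q I k (set_of S) (set_of T) m' U' ->
    j <= m' /\ j <= 2 ^ size C.
  case/reconf_path=> q [pathq lastq leq1 leq2].
  have fq := find_walk_complete S_uniq pathq lastq.
  suff : j <= size q by lia.
  by rewrite leqNgt; apply: contra fq => ltqj; rewrite minj.
(* The walk found is itself a reconfiguration sequence, so [short] applied to it bounds its length
   by the fuel, which [shortest_walk_some] does not record. *)
have [_ lej] := short _ _ recp.
split=> //; first by lia.
- move=> V /(map_f set_of); rewrite defus inE => inV x xV.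
  have VC : set_of V `<=` set_of C.
    case/predU1P: inV => [-> | ]; first exact: S_sub.
    exact: path_sub pathp S_sub _.
  by rewrite -in_set_of; apply: (fsubsetP VC); rewrite in_set_of.
- by rewrite szus defus; split=> // m' U' /short[]; rewrite /= szp.
Qed.

Lemma answer_none :
  answer = None ->
  forall m U, ~ reconf_sequence Q I k (set_of S) (set_of T) m U.
Proof.
move=> ans m U /reconf_path[p [pathp lastp _ lep]].
have /eqP[] := find_walk_complete S_uniq pathp lastp.
by apply: (shortest_walk_none ans); lia.
Qed.

End Reconfiguration.

(** * The program *)

Definition Fst (e : expr) : expr := Case e Nil (Var 0).
Definition Snd (e : expr) : expr := Case e Nil (Var 1).
Definition TrueExpr : expr := Cons Nil Nil.

Definition fn_word_eq := 1.
Definition fn_mem := 2.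
Definition fn_subset := 3.
Definition fn_has_subset := 4.
Definition fn_half := 5.
Definition fn_leq_bits := 6.
Definition fn_toggle := 7.
Definition fn_union := 8.
Definition fn_unions := 9.
Definition fn_dbl := 10.
Definition fn_pow2 := 11.
Definition fn_feasible := 12.
Definition fn_walk := 13.
Definition fn_try := 14.
Definition fn_search := 15.
Definition fn_shortest := 16.
Definition fn_within := 17.

Section Library.

Variable p : program.

(* The functions of the enumeration program come first in the linked table, so
   that its own calls keep their meaning; function 0 of the library is its main
   expression. *)
Definition fn (i : nat) : nat := size (defs p) + i.
Definition Call1 (i : nat) (e : expr) : expr := Call (fn i) e.
Definition Call2 (i : nat) (e1 e2 : expr) : expr := Call1 i (Cons e1 e2).

(** In all the bodies below, the branch for false or empty comes first, as both are [Leaf], and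
    every [Node] branch shifts the outer variables by two. *)
Definition word_eq_body : expr :=
  Case (Fst (Var 0))
    (Case (Snd (Var 0)) TrueExpr Nil)
    (Case (Snd (Var 2)) Nil
      (Case (Var 2)
        (Case (Var 0) (Call2 fn_word_eq (Var 3) (Var 1)) Nil)
        (Case (Var 2) Nil (Call2 fn_word_eq (Var 7) (Var 5))))).

Definition mem_body : expr :=
  Case (Snd (Var 0)) Nil
    (Case (Call2 fn_word_eq (Var 0) (Fst (Var 2)))
      (Call2 fn_mem (Fst (Var 2)) (Var 1))
      TrueExpr).

Definition subset_body : expr :=
  Case (Fst (Var 0)) TrueExpr
    (Case (Call2 fn_mem (Var 0) (Snd (Var 2))) Nil
      (Call2 fn_subset (Var 3) (Snd (Var 4)))).

Definition has_subset_body : expr :=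
  Case (Fst (Var 0)) Nil
    (Case (Call2 fn_subset (Var 0) (Snd (Var 2)))
      (Call2 fn_has_subset (Var 1) (Snd (Var 2)))
      TrueExpr).

Definition half_body : expr :=
  Case (Var 0) Nil (Cons Nil (Case (Var 1) Nil (Call1 fn_half (Var 1)))).

(** Compares the length n of a list with a binary number b + 2v, using that for n > 0 the inequality
    n <= b + 2v means that (n - b) / 2, rounded up, is at most v. Expanding the number in unary is
    not an option: the bound on the length is part of the input, not of the parameter. *)
Definition leq_bits_body : expr :=
  Case (Fst (Var 0)) TrueExpr
    (Case (Snd (Var 2)) Nil
      (Case (Var 0)
        (Call2 fn_leq_bits (Call1 fn_half (Fst (Var 4))) (Var 1))
        (Call2 fn_leq_bits (Call1 fn_half (Var 5)) (Var 3)))).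

Definition toggle_body : expr :=
  Case (Snd (Var 0)) (Cons (Fst (Var 0)) Nil)
    (Case (Call2 fn_word_eq (Var 0) (Fst (Var 2)))
      (Cons (Var 0) (Call2 fn_toggle (Fst (Var 2)) (Var 1)))
      (Var 3)).

Definition union_body : expr :=
  Case (Fst (Var 0)) (Snd (Var 0))
    (Call2 fn_union (Var 1)
      (Case (Call2 fn_mem (Var 0) (Snd (Var 2)))
        (Cons (Var 0) (Snd (Var 2)))
        (Snd (Var 4)))).

Definition unions_body : expr :=
  Case (Fst (Var 0)) (Snd (Var 0))
    (Call2 fn_unions (Var 1) (Call2 fn_union (Var 0) (Snd (Var 2)))).

Definition dbl_body : expr :=
  Case (Var 0) Nil (Cons Nil (Cons Nil (Call1 fn_dbl (Var 1)))).

Definition pow2_body : expr :=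
  Case (Var 0) TrueExpr (Call1 fn_dbl (Call1 fn_pow2 (Var 1))).

(* The argument is [(U, (L, k))]. *)
Definition feasible_body : expr :=
  Case (Call2 fn_leq_bits (Fst (Var 0)) (Snd (Snd (Var 0)))) Nil
    (Call2 fn_has_subset (Fst (Snd (Var 2))) (Fst (Var 2))).

(* The argument is [(m, (U, (C, (T, (L, k)))))], with [m] in unary. *)
Definition walk_body : expr :=
  let U i := Fst (Snd (Var i)) in
  let C i := Fst (Snd (Snd (Var i))) in
  let T i := Fst (Snd (Snd (Snd (Var i)))) in
  Case (Fst (Var 0))
    (Case (Call2 fn_subset (U 0) (T 0)) Nil
      (Case (Call2 fn_subset (T 2) (U 2)) Nil
        (Cons (Cons (U 4) Nil) Nil)))
    (Call2 fn_try (C 2) (Cons (Var 1) (Snd (Var 2)))).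

(* The argument is [(Cr, (m, (U, (C, (T, (L, k))))))]; the moves still to be
   tried are those that toggle a word of [Cr]. *)
Definition try_body : expr :=
  let m i := Fst (Snd (Var i)) in
  let U i := Fst (Snd (Snd (Var i))) in
  let ctx i := Snd (Snd (Snd (Var i))) in
  let Lk i := Snd (Snd (ctx i)) in
  Case (Fst (Var 0)) Nil
    (Let (Call2 fn_toggle (Var 0) (U 2))
      (Case (Call2 fn_feasible (Var 0) (Lk 3))
        (Call2 fn_try (Var 2) (Snd (Var 3)))
        (Case (Call2 fn_walk (m 5) (Cons (Var 2) (ctx 5)))
          (Call2 fn_try (Var 4) (Snd (Var 5)))
          (Cons (Cons (U 7) (Var 0)) Nil)))).

(* The argument is [(fuel, (m, (U, ctx)))], with [fuel] and [m] in unary. *)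
Definition search_body : expr :=
  Case (Call1 fn_walk (Snd (Var 0)))
    (Case (Fst (Var 0)) Nil
      (Call2 fn_search (Var 1)
        (Cons (Cons Nil (Fst (Snd (Var 2)))) (Snd (Snd (Var 2))))))
    (Cons (Var 0) Nil).

(* The argument is [(I, (k, (S, T)))]. *)
Definition shortest_body : expr :=
  let S i := Fst (Snd (Snd (Var i))) in
  let T i := Snd (Snd (Snd (Var i))) in
  let k i := Fst (Snd (Var i)) in
  Let (Call2 0 (Fst (Var 0)) (k 0))
    (Let (Call2 fn_unions (Var 0)
           (Call2 fn_union (S 1) (Call2 fn_union (T 1) Nil)))
      (Call2 fn_search (Call1 fn_pow2 (Var 0))
        (Cons Nil (Cons (S 2) (Cons (Var 0) (Cons (T 2)
          (Cons (Var 1) (k 2)))))))).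

(* The argument is [((I, (k, (S, T))), l)]. *)
Definition within_body : expr :=
  Case (Fst (Snd (Var 0)))
    (Let (Call1 fn_shortest (Fst (Var 0)))
      (Case (Var 0) Nil
        (Case (Call2 fn_leq_bits (Snd (Var 0)) (Snd (Snd (Var 3)))) Nil
          (Var 4))))
    Nil.

Definition library : seq expr :=
  [:: main p; word_eq_body; mem_body; subset_body; has_subset_body; half_body;
      leq_bits_body; toggle_body; union_body; unions_body; dbl_body; pow2_body;
      feasible_body; walk_body; try_body; search_body; shortest_body;
      within_body].

Definition linked : seq expr := defs p ++ library.

(** Upper bounds in place of exact step counts, so that costs compose and can be weakened by
    arithmetic. *)
Definition evalb (env : seq data) (e : expr) (v : data) (T : nat) : Prop :=
  exists2 t, t <= T & eval linked env e v t.

Definition calls (i : nat) (u v : data) (T : nat) : Prop :=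
  evalb [:: u] (nth Nil library i) v T.

Lemma evalb_le env e v T T' : evalb env e v T -> T <= T' -> evalb env e v T'.
Proof. by case=> t le_t ev le_T; exists t => //; apply: leq_trans le_T. Qed.

Lemma calls_le i u v T T' : calls i u v T -> T <= T' -> calls i u v T'.
Proof. exact: evalb_le. Qed.

Lemma evalb_var env i : evalb env (Var i) (nth Leaf env i) 1.
Proof. by exists 1 => //; exact: eval_var. Qed.

Lemma evalb_nil env : evalb env Nil Leaf 1.
Proof. by exists 1 => //; exact: eval_nil. Qed.

Lemma evalb_cons env e1 e2 v1 v2 T1 T2 :
  evalb env e1 v1 T1 -> evalb env e2 v2 T2 ->
  evalb env (Cons e1 e2) (Node v1 v2) (T1 + T2).+1.
Proof.
move=> [t1 le1 ev1] [t2 le2 ev2]; exists (t1 + t2).+1; first by lia.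
exact: eval_cons.
Qed.

Lemma evalb_case_leaf env e e0 e1 v T T0 :
  evalb env e Leaf T -> evalb env e0 v T0 ->
  evalb env (Case e e0 e1) v (T + T0).+1.
Proof.
move=> [t1 le1 ev1] [t2 le2 ev2]; exists (t1 + t2).+1; first by lia.
exact: eval_case_leaf.
Qed.

Lemma evalb_case_node env e e0 e1 a b v T T1 :
  evalb env e (Node a b) T -> evalb [:: a, b & env] e1 v T1 ->
  evalb env (Case e e0 e1) v (T + T1).+1.
Proof.
move=> [t1 le1 ev1] [t2 le2 ev2]; exists (t1 + t2).+1; first by lia.
exact: eval_case_node ev1 ev2.
Qed.

Lemma evalb_let env e e1 u v T T1 :
  evalb env e u T -> evalb (u :: env) e1 v T1 ->
  evalb env (Let e e1) v (T + T1).+1.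
Proof.
move=> [t1 le1 ev1] [t2 le2 ev2]; exists (t1 + t2).+1; first by lia.
exact: eval_let ev1 ev2.
Qed.

Lemma evalb_call env i e u v T T1 :
  i < size library -> evalb env e u T -> calls i u v T1 ->
  evalb env (Call1 i e) v (T + T1).+1.
Proof.
move=> lti [t1 le1 ev1] [t2 le2 ev2]; exists (t1 + t2).+1; first by lia.
apply: eval_call ev1 _; first by rewrite size_cat ltn_add2l.
by rewrite /linked nth_cat /fn ltnNge leq_addr addKn.
Qed.

(** The branch of a [Case] is found by trial: the value of the scrutinee must unify with [Leaf] or
    with a [Node]. For a call that value comes from a hypothesis, which is why the lemmas below
    split on its result before [run]. The time stays an evar until the final inequality. *)
Ltac ev :=
  lazymatch goal with
  | |- evalb _ (Var _) _ _ => apply: evalb_var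
  | |- evalb _ Nil _ _ => apply: evalb_nil
  | |- evalb _ TrueExpr _ _ => rewrite /TrueExpr; ev
  | |- evalb _ (Fst _) _ _ => rewrite /Fst; ev
  | |- evalb _ (Snd _) _ _ => rewrite /Snd; ev
  | |- evalb _ (Call2 _ _ _) _ _ => rewrite /Call2; ev
  | |- evalb _ (Cons _ _) _ _ => eapply evalb_cons; [ev | ev]
  | |- evalb _ (Let _ _) _ _ => eapply evalb_let; [ev | ev]
  | |- evalb _ (Call1 _ _) _ _ =>
      eapply evalb_call; [exact: isT | ev | try eassumption]
  | |- evalb _ (Case _ _ _) _ _ =>
      first [ eapply evalb_case_leaf; [solve [ev] | ev]
            | eapply evalb_case_node; [solve [ev] | ev] ]
  end.

Lemma calls_body b i u v T T' :
  nth Nil library i = b -> evalb [:: u] b v T -> T <= T' -> calls i u v T'.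
Proof. by move=> <-; exact: evalb_le. Qed.

Ltac run b :=
  let b1 := eval red in b in let b' := eval cbv beta zeta in b1 in
  eapply (@calls_body b'); [reflexivity | ev | ].

(** * Running times of the functions on words, lists and numbers *)

Lemma enc_word_size w : size w < dsize (enc_word w).
Proof. by elim: w => //= b w; case: b => /=; lia. Qed.

Lemma word_eq_calls u v :
  calls fn_word_eq (Node (enc_word u) (enc_word v)) (enc_bool (u == v))
    (40 * dsize (enc_word u)).
Proof.
apply: calls_le (_ : calls _ _ _ (40 * (size u).+1)) _; last first.
  have := enc_word_size u; lia.
elim: u v => [|b u IHu] [|c v] /=; try by run word_eq_body; lia.
have {IHu} := IHu v.
rewrite eqseq_cons; case: b; case: c => //= H; run word_eq_body; lia.
Qed.

(** The first factor counts the lengths 0, ..., 2^c to be tried; the second bounds the search tree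
    of the longest one. *)
Definition search_factor (c : nat) : nat := (2 ^ c).+1 * (2 * c + 2) ^ (2 ^ c).

Lemma dsize_gt0 d : 0 < dsize d. Proof. by case: d. Qed.

Lemma listing_size l : size l < dsize (enc_listing l).
Proof. by elim: l => //= w l; lia. Qed.

Lemma listings_size L : size L < dsize (enc_listings L).
Proof. by elim: L => //= w l; lia. Qed.

Lemma mem_calls w l :
  calls fn_mem (Node (enc_word w) (enc_listing l)) (enc_bool (w \in l))
    (60 * dsize (enc_listing l)).
Proof.
elim: l => [|x l IH] /=; first by run mem_body.
have gt0 := dsize_gt0 (enc_listing l).
rewrite in_cons eq_sym.
by have := word_eq_calls x w; case: eqP => /= _ H; run mem_body; lia.
Qed.

Lemma subset_calls A B :
  calls fn_subset (Node (enc_listing A) (enc_listing B))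
    (enc_bool (all [in B] A)) ((size A).+1 * (80 * dsize (enc_listing B))).
Proof.
have gt0 := dsize_gt0 (enc_listing B).
elim: A => [|x A IH] /=; first by run subset_body; lia.
by have := mem_calls x B; case: (x \in B) => /= H; run subset_body; lia.
Qed.

Lemma has_subset_calls L U :
  calls fn_has_subset (Node (enc_listings L) (enc_listing U))
    (enc_bool (has (all [in U]) L))
    (dsize (enc_listings L) * (100 * dsize (enc_listing U))).
Proof.
have gt0 := dsize_gt0 (enc_listing U).
elim: L => [|A L IH] /=; first by run has_subset_body; lia.
have ltA := listing_size A.
by have := subset_calls A U; case: (all [in U] A) => /= H;
  run has_subset_body; nia.
Qed.

(** Only the right spine counts, so lists of any kind can be used directly as unary numbers. *)
Fixpoint dlen (d : data) : nat := if d is Node _ b then (dlen b).+1 else 0.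

Definition unary (m : nat) : data := iter m (Node Leaf) Leaf.

Lemma dlen_unary m : dlen (unary m) = m.
Proof. by elim: m => //= m ->. Qed.

Lemma half_calls d :
  calls fn_half d (unary (uphalf (dlen d))) (20 * (dlen d).+1).
Proof.
have [n le_dn] := ubnP (dlen d).
elim: n d le_dn => [//|n IH] [|a [|b d]] //= le_dn; try by run half_body; lia.
have {}IH := IH d ltac:(lia).
by run half_body; lia.
Qed.

Fixpoint bits_val (bs : word) : nat :=
  if bs is b :: bs' then b + (bits_val bs').*2 else 0.

Lemma nat_bitsK n : bits_val (nat_bits n) = n.
Proof.
rewrite -[RHS]bin_of_natK /nat_bits; case: (bin_of_nat n) => //=.
by elim=> //= q ->; rewrite NatTrec.doubleE ?add1n.
Qed.

Lemma leq_bits_calls d bs :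
  calls fn_leq_bits (Node d (enc_word bs)) (enc_bool (dlen d <= bits_val bs))
    ((size bs).+1 * (40 * (dlen d).+1)).
Proof.
elim: bs d => [|b bs IH] [|x d] /=; try by run leq_bits_body; lia.
case: b => /=.
- have H := half_calls d; have := IH (unary (uphalf (dlen d))).
  rewrite dlen_unary.
  have -> : (uphalf (dlen d) <= bits_val bs) = (dlen d < 1 + (bits_val bs).*2).
    by lia.
  by move=> H'; run leq_bits_body; nia.
- have H := half_calls (Node x d); have := IH (unary (uphalf (dlen d).+1)).
  rewrite dlen_unary.
  have -> : (uphalf (dlen d).+1 <= bits_val bs)
            = (dlen d < 0 + (bits_val bs).*2).
    by lia.
  by move=> H'; run leq_bits_body; rewrite [dlen _]/=; nia.
Qed.

Lemma toggle_calls w U :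
  calls fn_toggle (Node (enc_word w) (enc_listing U))
    (enc_listing (toggled w U))
    (60 * dsize (enc_listing U)).
Proof.
elim: U => [|x U IH] /=; first by run toggle_body.
have gt0 := dsize_gt0 (enc_listing U).
have := word_eq_calls x w.
by case: (x == w) => /= H; run toggle_body; lia.
Qed.

Lemma merged_size l acc :
  dsize (enc_listing (merged l acc))
  <= dsize (enc_listing l) + dsize (enc_listing acc).
Proof.
elim: l acc => [|x l IH] acc /=; first by lia.
by apply: leq_trans (IH _) _; case: ifP => _ /=; lia.
Qed.

(** The accumulator grows by no more than [l] shrinks, so the sum of the two sizes never increases
    and bounds the membership test of every round. The same potential serves for [unions_calls]. *)
Lemma union_calls l acc :
  calls fn_union (Node (enc_listing l) (enc_listing acc))
    (enc_listing (merged l acc))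
    ((size l).+1 * (80 * (dsize (enc_listing l) + dsize (enc_listing acc)))).
Proof.
elim: l acc => [|x l IH] acc /=; first by run union_body; lia.
have gt0 := dsize_gt0 (enc_listing acc).
have gt0' := dsize_gt0 (enc_word x).
have := mem_calls x acc; have := IH (if x \in acc then acc else x :: acc).
by case: ifP => _ /= H' H; run union_body; nia.
Qed.

Lemma merged_all_size L acc :
  dsize (enc_listing (merged_all L acc))
  <= dsize (enc_listings L) + dsize (enc_listing acc).
Proof.
elim: L acc => [|A L IH] acc /=; first by lia.
by apply: leq_trans (IH _) _; have := merged_size A acc; lia.
Qed.

Lemma unions_calls L acc :
  calls fn_unions (Node (enc_listings L) (enc_listing acc))
    (enc_listing (merged_all L acc))
    (dsize (enc_listings L)
     * (100 * (dsize (enc_listings L) + dsize (enc_listing acc)))).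
Proof.
elim: L acc => [|A L IH] acc /=.
  by have gt0 := dsize_gt0 (enc_listing acc); run unions_body; lia.
have gt0 := dsize_gt0 (enc_listing acc).
have gt0' := dsize_gt0 (enc_listings L).
have ltA := listing_size A.
have le_m := merged_size A acc.
have H := union_calls A acc; have H' := IH (merged A acc).
by run unions_body; nia.
Qed.

Lemma dbl_calls m : calls fn_dbl (unary m) (unary m.*2) (20 * m.+1).
Proof. by elim: m => [|m IH] /=; run dbl_body; lia. Qed.

Lemma pow2_calls (l : seq word) :
  calls fn_pow2 (enc_listing l) (unary (2 ^ size l)) (60 * 2 ^ size l).
Proof.
elim: l => [|x l IH] /=; first by run pow2_body.
have := dbl_calls (2 ^ size l); rewrite -mul2n -expnS => H.
have gt0 := expn_gt0 2 (size l).
by run pow2_body; rewrite expnS; lia.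
Qed.

Lemma dlen_listing U : dlen (enc_listing U) = size U.
Proof. by elim: U => //= w U ->. Qed.

Lemma feasible_calls L k U :
  calls fn_feasible
    (Node (enc_listing U) (Node (enc_listings L) (enc_nat k)))
    (enc_bool (feasible L k U))
    (dsize (enc_nat k) * (80 * dsize (enc_listing U))
     + dsize (enc_listings L) * (100 * dsize (enc_listing U)) + 60).
Proof.
have H' := has_subset_calls L U.
have := leq_bits_calls (enc_listing U) (nat_bits k).
have ltk : size (nat_bits k) < dsize (enc_nat k) by exact: enc_word_size.
have ltU := listing_size U.
rewrite dlen_listing nat_bitsK /feasible.
case: (size U <= k) => /= H; run feasible_body; nia.
Qed.

Lemma listing_dsize (w : word) (C : seq word) :
  w \in C -> (dsize (enc_word w)).+1 < dsize (enc_listing C).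
Proof.
elim: C => //= x C IH; rewrite inE => /predU1P[-> | /IH]; last by lia.
by have := dsize_gt0 (enc_listing C); lia.
Qed.

(** A crude count: at most |C| words, each with an encoding smaller than the listing of [C]. *)
Lemma sub_listing_dsize (U C : seq word) :
  uniq U -> {subset U <= C} ->
  dsize (enc_listing U) <= dsize (enc_listing C) ^ 2.
Proof.
move=> uU UC; have leU : size U <= size C := uniq_leq_size uU UC;
  have ltC := listing_size C.
apply: (@leq_trans (1 + size U * dsize (enc_listing C))); last first.
  by rewrite -mulnn; nia.
elim: U UC {uU leU} => //= w U IH UC.
have ltw := listing_dsize (UC w (mem_head _ _)).
by have := IH (fun x xU => UC x (mem_behead (s := w :: U) xU)); nia.
Qed.

(** * Running time of the exhaustive search *)

Section Search.

Variables (C T : seq word) (L : seq (seq word)) (k : nat).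

Let context : data :=
  Node (enc_listing C)
    (Node (enc_listing T) (Node (enc_listings L) (enc_nat k))).

Definition search_size : nat :=
  dsize (enc_listing C) ^ 2 + dsize (enc_listing T) + dsize (enc_listings L)
  + dsize (enc_nat k).

Definition step_time : nat := 1000 * (search_size * search_size).

(** Each of the |C| moves pays one test and one shorter search, together at most twice the bound for
    the latter; the summand 2 absorbs the overhead of the calls. *)
Definition walk_time (m : nat) : nat := step_time * (2 * size C + 2) ^ m.

(** The invariant that keeps the current set polynomially small however long the walk is. *)
Let state (U : seq word) : Prop := uniq U /\ {subset U <= C}.

Lemma state_toggled w U : w \in C -> state U -> state (toggled w U).
Proof.
move=> wC [uU UC]; split=> [|x]; first exact: uniq_toggled.
rewrite mem_toggled //; case: (x =P w) => [-> // | _].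
by rewrite addbF; apply: UC.
Qed.

Lemma state_dsize U : state U -> dsize (enc_listing U) <= search_size.
Proof.
by case=> uU UC; have := sub_listing_dsize uU UC; rewrite /search_size; lia.
Qed.

(** [fn_walk] and [fn_try] call each other. The induction here is on the words still to be tried,
    with the bound for walks of [m] steps as a premise; the induction on [m] in [walk_calls]
    supplies it. *)
Lemma try_calls m (U Cr : seq word) :
  (forall V, state V ->
     calls fn_walk (Node (unary m) (Node (enc_listing V) context))
       (enc_option enc_listings (find_walk C T L k m V)) (walk_time m)) ->
  state U -> {subset Cr <= C} ->
  calls fn_try
    (Node (enc_listing Cr) (Node (unary m) (Node (enc_listing U) context)))
    (enc_option enc_listings (try_moves L k (find_walk C T L k m) U Cr))
    (100 + size Cr * (step_time + walk_time m)).
Proof.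
move=> walkP stU; elim: Cr => [|w Cr IH] CrC; first by run try_body.
have {}IH := IH (fun x xC => CrC x (mem_behead (s := w :: Cr) xC)).
have stU' := state_toggled (CrC w (mem_head _ _)) stU.
have Ht := toggle_calls w U; have Hw := walkP _ stU'.
have := feasible_calls L k (toggled w U).
have leU := state_dsize stU; have leU' := state_dsize stU'.
have leL : dsize (enc_listings L) <= search_size by rewrite /search_size; lia.
have lek : dsize (enc_nat k) <= search_size by rewrite /search_size; lia.
have gt0 := dsize_gt0 (enc_nat k).
have bound : 60 * dsize (enc_listing U)
    + (dsize (enc_nat k) * (80 * dsize (enc_listing (toggled w U)))
       + dsize (enc_listings L) * (100 * dsize (enc_listing (toggled w U)))
       + 60) + 300 <= step_time.
  have := leq_mul leL leU'; have := leq_mul lek leU'.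
  by rewrite /step_time; nia.
rewrite /=; case: (feasible _ _ _) => /= Hf; last by run try_body; lia.
by case: (find_walk _ _ _ _ _ _) Hw => [W|] /= Hw; run try_body; lia.
Qed.

Lemma walk_calls m U :
  state U ->
  calls fn_walk (Node (unary m) (Node (enc_listing U) context))
    (enc_option enc_listings (find_walk C T L k m U)) (walk_time m).
Proof.
elim: m U => [|m IH] U stU.
  have leU := state_dsize stU; have ltU := listing_size U.
  have leT : dsize (enc_listing T) <= search_size by rewrite /search_size; lia.
  have ltT := listing_size T.
  rewrite /walk_time expn0 muln1 /step_time /=.
  have H2 := subset_calls T U; have := subset_calls U T.
  case: (all [in T] U) => /= H1; last by run walk_body; nia.
  by case: (all [in U] T) H2 => /= H2; run walk_body; nia.
have H := try_calls IH stU (fun=> id).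
rewrite /=; run walk_body; rewrite /walk_time expnS.
have pos : 0 < (2 * size C + 2) ^ m by rewrite expn_gt0; lia.
have : 1000 <= step_time.
  by have := dsize_gt0 (enc_nat k); rewrite /step_time /search_size; nia.
move: (step_time) (_ ^ m) pos => A X; nia.
Qed.

Lemma search_calls fuel m U :
  state U ->
  calls fn_search
    (Node (unary fuel) (Node (unary m) (Node (enc_listing U) context)))
    (enc_option enc_listings (shortest_walk C T L k fuel m U))
    (fuel.+1 * (walk_time (m + fuel) + 100)).
Proof.
move=> stU; elim: fuel m => [|fuel IH] m; have := walk_calls m stU.
  by rewrite addn0 /=; case: (find_walk _ _ _ _ _ _) => [W|] /= H;
    run search_body; lia.
(* The sum of length and fuel is constant along the recursion, so the time for the longest walk
   bounds every round. *)
have {}IH := IH m.+1; rewrite addSnnS in IH.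
have le_t : walk_time m <= walk_time (m + fuel.+1).
  by rewrite leq_mul2l leq_pexp2l ?orbT ?leq_addr ?addn2.
by rewrite /=; case: (find_walk _ _ _ _ _ _) => [W|] /= H; run search_body; nia.
Qed.

End Search.

(** The exponent 4 arises because a step is quadratic in [search_size], itself at most 2 M^2; this
    gives the 4000 M^4 of [le_step]. The rest of 4900 pays for the enumeration, the unions, the
    power of two and the overhead. *)
Lemma shortest_calls x L t :
  let S := r_source x in let T := r_target x in
  let C := core L S T in
  let M := dsize (enc_reconf x) + (t + dsize (enc_listings L)) in
  uniq S ->
  calls 0 (Node (enc_word (r_inst x)) (enc_nat (r_k x))) (enc_listings L) t ->
  calls fn_shortest (enc_reconf x)
    (enc_option enc_listings (answer (r_k x) C S T L))
    (4900 * search_factor (size C) * M ^ 4).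
Proof.
case: x => I k S T /= uS enumP; set C := core L S T; set M := _ + _.
have H1 := union_calls T [::]; have H2 := union_calls S (merged T [::]).
have H3 := unions_calls L (merged S (merged T [::])).
have H4 := pow2_calls C.
have stS : uniq S /\ {subset S <= C}.
  by split=> // w wS; rewrite mem_core wS.
have H5 := search_calls T L k (2 ^ size C) 0 stS.
have leM1 := merged_size T [::]; have leM2 := merged_size S (merged T [::]).
have leM3 : dsize (enc_listing C) <= _ :=
  merged_all_size L (merged S (merged T [::])).
have ltS := listing_size S; have ltT := listing_size T.
have gtM : dsize (enc_listing S) + dsize (enc_listing T) + dsize (enc_nat k)
    + dsize (enc_listings L) + t + 3 <= M.
  by rewrite /M /=; lia.
rewrite /= in leM1.
have le_s : search_size C T L k <= 2 * (M * M).
  have := leq_mul (leq_trans leM3 _ : _ <= M) (leq_trans leM3 _ : _ <= M).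
  by rewrite /search_size -mulnn; nia.
have le_step : step_time C T L k <= 4000 * M ^ 4.
  rewrite /step_time; have := leq_mul le_s le_s.
  by rewrite !expnS expn0; lia.
have le1 : (size T).+1 * (80 * (dsize (enc_listing T) + 1)) <= 80 * (M * M).
  have leT : (size T).+1 <= M by lia.
  have leT' : dsize (enc_listing T) + 1 <= M by lia.
  by have := leq_mul leT leT'; lia.
have le2 : (size S).+1
    * (80 * (dsize (enc_listing S) + dsize (enc_listing (merged T [::]))))
    <= 80 * (M * M).
  have leS : (size S).+1 <= M by lia.
  have leS' : dsize (enc_listing S) + dsize (enc_listing (merged T [::])) <= M.
    by lia.
  by have := leq_mul leS leS'; lia.
have le3 : dsize (enc_listings L)
    * (100 * (dsize (enc_listings L)
              + dsize (enc_listing (merged S (merged T [::])))))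
    <= 100 * (M * M).
  have leL : dsize (enc_listings L) <= M by lia.
  have leL' : dsize (enc_listings L)
      + dsize (enc_listing (merged S (merged T [::]))) <= M by lia.
  by have := leq_mul leL leL'; lia.
have {}H1 := calls_le H1 le1; have {}H2 := calls_le H2 le2.
have {}H3 := calls_le H3 le3.
run shortest_body.
have leMZ : M * M <= M ^ 4 by rewrite mulnn leq_pexp2l //; lia.
have leM : M <= M * M by rewrite leq_pmulr //; lia.
have gt0M : 0 < M ^ 4 by rewrite expn_gt0; lia.
rewrite /search_factor /walk_time ?add0n.
have gt0 : 0 < (2 * size C + 2) ^ (2 ^ size C) by rewrite expn_gt0; lia.
move: (2 ^ size C) (_ ^ _) (M ^ 4) gt0 le_step leMZ gt0M => P X Z.
move=> gt0X le_step leMZ gt0Z.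
have leG : P.+1 <= P.+1 * X by rewrite leq_pmulr.
have leGZ : P.+1 * X <= P.+1 * X * Z by rewrite leq_pmulr.
have leZG : Z <= P.+1 * X * Z by rewrite leq_pmull ?muln_gt0.
have : P.+1 * (step_time C T L k * X + 100)
    <= 4000 * (P.+1 * X * Z) + 100 * P.+1.
  by have := leq_mul (leqnn (P.+1 * X)) le_step; rewrite mulnDr; lia.
lia.
Qed.

(** Sharing of subtrees makes the step count useless for the size of the output, which is therefore
    counted directly: boundedly many sets, each at most quadratic in the core. *)
Lemma answer_dsize (C : seq word) (us : seq (seq word)) :
  all uniq us -> size us <= (2 ^ size C).+1 ->
  {in us, forall V : seq word, {subset V <= C}} ->
  dsize (enc_listings us)
  <= 3 * search_factor (size C) * dsize (enc_listing C) ^ 2.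
Proof.
move=> /allP uus szus subC.
have : dsize (enc_listings us)
    <= 1 + size us * (dsize (enc_listing C) ^ 2 + 1).
  elim: us {szus} uus subC => //= V us IH uus subC.
  have {}IH := IH (fun V' inV => uus V' (mem_behead (s := V :: us) inV))
    (fun V' inV => subC V' (mem_behead (s := V :: us) inV)).
  have := sub_listing_dsize (uus V (mem_head _ _)) (subC V (mem_head _ _)).
  lia.
have gt0 : 0 < (2 * size C + 2) ^ (2 ^ size C) by rewrite expn_gt0; lia.
have gt0' : 0 < dsize (enc_listing C) ^ 2 by rewrite expn_gt0 dsize_gt0.
rewrite /search_factor; move: (2 ^ _) (_ ^ _) (_ ^ 2) gt0 gt0' szus => P X Z.
move=> gt0 gt0' szus.
have : size us * (Z + 1) <= P.+1 * X * (2 * Z).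
  by apply: leq_mul; nia.
have : 1 <= P.+1 * X * Z by nia.
lia.
Qed.

(* The length of a walk is the number of its sets minus one, hence the tail in
   the comparison with [l]. *)
Definition restrict (l : int) (r : option (seq (seq word)))
    : option (seq (seq word)) :=
  if r is Some us then
    if ~~ (l < 0)%R && ((size us).-1 <= `|l|%N) then Some us else None
  else None.

Lemma dlen_listings L : dlen (enc_listings L) = size L.
Proof. by elim: L => //= w L ->. Qed.

Lemma within_calls x r l t :
  calls fn_shortest (enc_reconf x) (enc_option enc_listings r) t ->
  calls fn_within (Node (enc_reconf x) (enc_int l))
    (enc_option enc_listings (restrict l r))
    (t + 100
     + dsize (enc_int l) * (40 * dsize (enc_option enc_listings r))).
Proof.
move=> Hs; rewrite /enc_int /restrict.
case: (l < 0)%R => /=.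
  by case: r Hs => [us|] Hs /=; run within_body; lia.
case: r Hs => [us|] /= Hs; last by run within_body; lia.
have ltl : size (nat_bits `|l|%N) < dsize (enc_nat `|l|%N).
  exact: enc_word_size.
(* No answer is the empty list, but [r] is arbitrary here; the program and [restrict] agree on it
   because the tail of [Leaf] is [Leaf] and the predecessor of 0 is 0. *)
case: us Hs => [|U us] /= Hs.
  have := leq_bits_calls Leaf (nat_bits `|l|%N).
  by rewrite nat_bitsK /= => H; run within_body; nia.
have := leq_bits_calls (enc_listings us) (nat_bits `|l|%N).
have lt_us := listings_size us.
rewrite nat_bitsK dlen_listings.
by case: (size us <= _) => /= H; run within_body; nia.
Qed.

Lemma main_call i u v t :
  i < size library -> calls i u v t ->
  evalb [:: u] (Call1 i (Var 0)) v (t + 10).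
Proof.
move=> lti H; eapply evalb_le.
  by eapply evalb_call; [exact: lti | ev | exact: H].
by lia.
Qed.

Lemma main_within u r t :
  calls fn_within u (enc_option enc_listings r) t ->
  evalb [:: u] (Case (Call1 fn_within (Var 0)) Nil TrueExpr)
    (enc_bool (isSome r)) (t + 10).
Proof. by case: r => [us|] /= H; (eapply evalb_le; [ev | lia]). Qed.

End Library.

(** * Fixed-parameter bounds *)

(** A call beyond the end of the table has no evaluation, so no call of the original program is
    captured by an appended function. *)
Lemma eval_cat F G env e v t : eval F env e v t -> eval (F ++ G) env e v t.
Proof.
elim=> {env e v t}; try by econstructor; eassumption.
move=> env f e u v t t1 ltf _ IHe _ IHf.
apply: eval_call IHe _; first by rewrite size_cat ltn_addr.
by rewrite nth_cat ltf.
Qed.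

Lemma core_dsize L S T :
  dsize (enc_listing (core L S T))
  <= dsize (enc_listings L) + dsize (enc_listing S) + dsize (enc_listing T) + 1.
Proof.
have := merged_size T [::]; have := merged_size S (merged T [::]).
by have := merged_all_size L (merged S (merged T [::])); rewrite /core /=; lia.
Qed.

(** The count goes through [A] instead of [L], whose entries may repeat the same set; the core has
    no repetitions, so it does not see them. *)
Lemma core_size Q I k S T L (A : {fset {fset word}}) :
  uniq S -> uniq T ->
  solution Q I k (set_of S) -> solution Q I k (set_of T) ->
  (forall X : {fset word}, X \in map set_of L <-> minimal_solution Q I k X) ->
  (forall X : {fset word}, X \in A <-> minimal_solution Q I k X) ->
  size (core L S T) <= #|` A| * k + k + k.
Proof.
move=> uS uT solS solT minL minA.
pose s := flatten [seq enum_fset X | X <- enum_fset A] ++ S ++ T.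
apply: (@leq_trans (size s)).
  apply: uniq_leq_size (uniq_core L S T) _ => w.
  rewrite mem_core !mem_cat => /or3P[-> | -> | ]; rewrite ?orbT //.
  case/hasP=> B BL wB; apply/orP; left; apply/flattenP.
  exists (enum_fset (set_of B)); last by rewrite in_set_of.
  by apply: map_f; apply/minA/minL/map_f.
rewrite /s !size_cat -addnA !leq_add //; first last.
- by rewrite -(card_set_of uT) (solution_card solT).
- by rewrite -(card_set_of uS) (solution_card solS).
have : {in enum_fset A, forall X : {fset word}, #|` X| <= k}.
  by move=> X /minA[/solution_card].
elim: (enum_fset A) => //= X l IH cardX; rewrite size_cat mulSn leq_add //.
  by apply: cardX; rewrite mem_head.
by apply: IH => Y inY; apply: cardX; rewrite inE inY orbT.
Qed.

Lemma leq_search_factor c c' :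
  c <= c' -> search_factor c <= search_factor c'.
Proof.
move=> lec; have leP : 2 ^ c <= 2 ^ c' by rewrite leq_pexp2l.
rewrite /search_factor leq_mul ?ltnS //.
apply: (@leq_trans ((2 * c + 2) ^ (2 ^ c'))).
  by rewrite leq_pexp2l // addn2.
by rewrite leq_exp2r ?expn_gt0 // leq_add2r leq_mul2l lec.
Qed.

Definition optimal (Q : subset_problem) (x : reconf_input)
    (r : option (seq (seq word))) : Prop :=
  if r is Some us then
    all uniq us /\ is_shortest (is_reconf Q x) (size us).-1 (map set_of us)
  else forall m U, ~ is_reconf Q x m U.

Lemma shortest_program (Q : subset_problem) :
  superset_closed Q -> in_FPT (minimal_enumeration Q) ->
  minimal_solutions_bounded Q ->
  exists (p : program) (g : nat -> nat) (c : nat),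
    forall x, r_valid Q x ->
      exists (r : option (seq (seq word))) (t : nat),
        [/\ calls p fn_shortest (enc_reconf x) (enc_option enc_listings r) t,
            t + dsize (enc_option enc_listings r)
            <= g (r_k x) * dsize (enc_reconf x) ^ c
          & optimal Q x r].
Proof.
move=> Q_closed [p [g [c enumP]]] [h boundedP].
pose factor k := search_factor (h k * k + k + k).
exists p, (fun k => 4910 * factor k * (1 + g k) ^ 4), (4 * c.+1).
move=> x [uS uT solS solT].
have [v [t [runp le_t [L [defv _ minL]]]]] := enumP (r_inst x, r_k x) Logic.I.
rewrite {}defv in runp le_t; rewrite /= in le_t minL runp.
have enumC : calls p 0 (Node (enc_word (r_inst x)) (enc_nat (r_k x)))
    (enc_listings L) t by exists t => //; exact: eval_cat runp.
have := shortest_calls uS enumC.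
set C := core _ _ _; set M := dsize (enc_reconf x) + _.
set r := answer _ _ _ _ _ => runC.
exists r, (4900 * search_factor (size C) * M ^ 4); split=> //.
- have [A [minA cardA]] := boundedP (r_inst x) (r_k x).
  have leC : size C <= h (r_k x) * r_k x + r_k x + r_k x.
    apply: leq_trans (core_size uS uT solS solT minL minA) _.
    by rewrite !leq_add2r leq_mul2r cardA orbT.
  have leG := leq_search_factor leC.
  set n := dsize (enc_reconf x).
  have n_gt0 : 0 < n by exact: dsize_gt0.
  (* The exponent [c.+1] instead of [c] lets the summand [n] of [M] be absorbed even when [c] is
     0. *)
  have leM : M <= (1 + g (r_k x)) * n ^ c.+1.
    rewrite mulnDl mul1n leq_add //.
      by rewrite -[X in X <= _]expn1 leq_pexp2l.
    apply: leq_trans le_t _; rewrite leq_mul2l; apply/orP; right.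
    apply: (@leq_trans (n ^ c)); last by rewrite leq_pexp2l.
    case: (posnP c) => [-> // | c_gt0]; rewrite leq_exp2r //.
    by rewrite /n /enc_reconf /=; lia.
  have leM4 : M ^ 4 <= (1 + g (r_k x)) ^ 4 * n ^ (4 * c.+1).
    by rewrite mulnC mulnC [4 * _]mulnC expnM -expnMn leq_exp2r.
  have : dsize (enc_option enc_listings r)
      <= 10 * search_factor (size C) * M ^ 4.
    have leCM : dsize (enc_listing C) <= M.
      apply: leq_trans (core_dsize _ _ _) _.
      by rewrite /M /enc_reconf /=; lia.
    have M_gt0 : 0 < M by apply: leq_trans (dsize_gt0 _) leCM.
    have leCM2 : dsize (enc_listing C) ^ 2 <= M ^ 4.
      by apply: (@leq_trans (M ^ 2)); rewrite ?leq_exp2r ?leq_pexp2l.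
    have pos : 0 < search_factor (size C) * M ^ 4.
      by rewrite /search_factor !muln_gt0 !expn_gt0 M_gt0 addn2.
    have bound := leq_mul (leqnn (search_factor (size C))) leCM2.
    case def_r: r => [us|] /=; last by lia.
    have [uus szus subC _] :=
      answer_some Q_closed uS solS solT minL (mem_core L _ _) def_r.
    have := answer_dsize uus szus subC.
    move: (search_factor _) (_ ^ 2) (M ^ 4) pos bound => G X Z; lia.
  have := leq_mul leG leM4.
  by rewrite -/(factor _); lia.
- case def_r: r => [us|] /=.
    have [uus _ _ shortus] :=
      answer_some Q_closed uS solS solT minL (mem_core L _ _) def_r.
    by split.
  by move=> m U; apply: answer_none minL (mem_core L _ _) def_r m U.
Qed.

(** A globally shortest sequence either respects the length bound, and is then shortest among those
    that do, or exceeds it, and then every sequence does. *)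
Lemma restrict_optimal Q x r l :
  optimal Q x r ->
  if restrict l r is Some us then
    all uniq us
    /\ is_shortest (is_reconf_within Q x l) (size us).-1 (map set_of us)
  else forall m U, ~ is_reconf_within Q x l m U.
Proof.
case: r => [us|] /=; last by move=> none m U [/none].
case=> uus [recus minus].
have leE m : (m%:Z <= l)%R = ~~ (l < 0)%R && (m <= `|l|%N) by lia.
case: ifP => [|/negbT gtl].
  by rewrite -leE => lel; split=> //; split=> // m' U' [/minus].
move=> m U [/minus lem]; rewrite leE => /andP[l0 lel].
by move: gtl; rewrite l0 (leq_trans lem lel).
Qed.

Lemma optimal_answer (good : nat -> seq {fset word} -> Prop) r :
  (if r is Some us then
     all uniq us /\ is_shortest good (size us).-1 (map set_of us)
   else forall m U, ~ good m U) ->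
  sequence_answer good (enc_option enc_listings r)
  /\ sequence_answer (is_shortest good) (enc_option enc_listings r).
Proof.
case: r => [us|] => [[uus short] | none]; split.
- by left; exists (size us).-1, us; case: short.
- by left; exists (size us).-1, us.
- by right.
- by right; split=> // m U [/none].
Qed.

Theorem theorem1 (Q : subset_problem)
    (Q_closed : superset_closed Q)
    (Q_enum : in_FPT (minimal_enumeration Q))
    (Q_bounded : minimal_solutions_bounded Q) :
  [/\ in_FPT (reconfiguration Q),
      in_FPT (reconfiguration_search Q),
      in_FPT (reconfiguration_shortest_within Q)
    & in_FPT (reconfiguration_shortest Q)].
Proof.
have [p [g [c shortP]]] := shortest_program Q_closed Q_enum Q_bounded.
(* Comparing the length with the binary [l] multiplies the size of the answer by that of [l], hence
   one more power of the input size. The successor of [g] pays for constants when [g] vanishes, and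
   the 10 for the main expression. *)
have withinP (x : reconf_input * int) : r_valid Q x.1 ->
    exists (r : option (seq (seq word))) (t : nat),
      let u := Node (enc_reconf x.1) (enc_int x.2) in
      [/\ calls p fn_within u (enc_option enc_listings (restrict x.2 r)) t,
          t + dsize (enc_option enc_listings (restrict x.2 r)) + 10
          <= (300 * (g (r_k x.1)).+1) * dsize u ^ c.+1
        & optimal Q x.1 r].
  move=> /shortP[r [t [runr le_t optr]]].
  exists r; eexists=> u; split=> //; first exact: within_calls runr.
  have le_r : dsize (enc_option enc_listings (restrict x.2 r))
      <= dsize (enc_option enc_listings r).
    by case: r {runr le_t optr} => //= us; case: ifP => _ //=; lia.
  have : dsize (enc_reconf x.1) ^ c <= dsize u ^ c.
    case: (posnP c) => [-> // | c_gt0]; rewrite leq_exp2r //.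
    by rewrite /u /=; lia.
  have lel : dsize (enc_int x.2) <= dsize u.
    by rewrite /u; move: (enc_int _) (enc_reconf _) => a b /=; lia.
  have gt0 : 0 < dsize u ^ c by rewrite expn_gt0 dsize_gt0.
  have u_gt0 := dsize_gt0 u.
  rewrite expnS.
  move: (dsize u) (dsize u ^ c) (dsize (enc_reconf x.1) ^ c) (g _)
    lel gt0 u_gt0 le_t => N Y X K lel Y_gt0 N_gt0 le_t leXY.
  have leB : t + dsize (enc_option enc_listings r) <= K * Y.
    by apply: leq_trans le_t _; rewrite leq_mul2l leXY orbT.
  have leNB := leq_mul lel (leq_trans (leq_addl _ _) leB).
  have : K * Y <= N * (K * Y) by rewrite leq_pmull.
  have : Y <= N * Y by rewrite leq_pmull.
  lia.
have searchP (x : reconf_input * int) : r_valid Q x.1 ->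
    exists v t,
      [/\ runs (Program (linked p) (Call1 p fn_within (Var 0)))
            (Node (enc_reconf x.1) (enc_int x.2)) v t,
          t + dsize v
          <= 300 * (g (r_k x.1)).+1
             * dsize (Node (enc_reconf x.1) (enc_int x.2)) ^ c.+1
        & sequence_answer (is_reconf_within Q x.1 x.2) v
          /\ sequence_answer (is_shortest (is_reconf_within Q x.1 x.2)) v].
  case/withinP=> r [t [runr le_t optr]].
  have [s les evs] := main_call (isT : fn_within < size (library p)) runr.
  exists (enc_option enc_listings (restrict x.2 r)), s; split=> //.
    by apply: leq_trans le_t; lia.
  exact: optimal_answer (restrict_optimal x.2 optr).
split.
- exists (Program (linked p) (Case (Call1 p fn_within (Var 0)) Nil TrueExpr)).
  exists (fun k => 300 * (g k).+1), c.+1 => x /withinP[r [t [runr le_t optr]]].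
  have [s les evs] := main_within runr.
  exists (enc_bool (isSome (restrict x.2 r))), s; split=> //.
    apply: leq_trans le_t.
    case: (restrict _ _) => [us|] /=; last by lia.
    by have := dsize_gt0 (enc_listings us); lia.
  exists (isSome (restrict x.2 r)); split=> //.
  have := restrict_optimal x.2 optr; case: (restrict _ _) => [us|] /=.
    by case=> _ [good _]; split=> // _; exists (size us).-1, (map set_of us).
  by move=> none; split=> // -[m [U good]]; case: (none m U).
- exists (Program (linked p) (Call1 p fn_within (Var 0))).
  exists (fun k => 300 * (g k).+1), c.+1 => x /searchP[v [t [runv le_t []]]].
  by exists v, t.
- exists (Program (linked p) (Call1 p fn_within (Var 0))).
  exists (fun k => 300 * (g k).+1), c.+1 => x /searchP[v [t [runv le_t []]]].
  by exists v, t.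
- exists (Program (linked p) (Call1 p fn_shortest (Var 0))).
  exists (fun k => 20 * (g k).+1), c => x /shortP[r [t [runr le_t optr]]].
  have [s les evs] := main_call (isT : fn_shortest < size (library p)) runr.
  exists (enc_option enc_listings r), s; split=> //.
    have : 0 < dsize (enc_reconf x) ^ c by rewrite expn_gt0 dsize_gt0.
    by rewrite /=; move: (_ ^ c) le_t => N; lia.
  by have [] := optimal_answer optr.
Qed.
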